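(* Let $G$ be a connected graph of diameter $2$ such that the set of minimal vertex separators of $G$ contains at least one minimal vertex separator of cardinality $2$. If $\lambda_2(G) < -1/2$, then $G$ is (isomorphic to) a connected induced subgraph of some relaxed block star.
   Context: All graphs are finite, simple and connected. $d_G(u,v)$ is the length of a shortest path between $u$ and $v$, and $\mathrm{diam}(G)$ is the maximum of $d_G(u,v)$. The distance matrix of $G$ with vertices $v_1,\dots,v_n$ is $\mathbf{D}(G)=[d_G(v_i,v_j)]$; its (real) eigenvalues, counted with multiplicity, are ordered $\lambda_1(G)\ge\lambda_2(G)\ge\cdots\ge\lambda_n(G)$, so $\lambda_2(G)$ is the second largest distance eigenvalue. For non-adjacent vertices $u,v$, a set $S$ of vertices is a $uv$-separator if removing $S$ puts $u$ and $v$ in distinct connected components; it is a minimal $uv$-separator if no proper subset of $S$ is a $uv$-separator. A minimal vertex separator (mvs) is a set that is a minimal $uv$-separator for some pair of non-adjacent vertices $u,v$. A block of a graph is a maximal connected subgraph that has no cut vertex. A vertex is universal if it is adjacent to all other vertices. The diamond is $K_4$ minus one edge. The full house is the 5-vertex graph consisting of a $K_4$ together with one further vertex adjacent to exactly two vertices of the $K_4$ (the house graph plus the two diagonals of its 4-cycle). A relaxed block star is a graph that has a universal vertex, has at least one minimal vertex separator of cardinality $2$, and all of whose blocks are cliques (complete graphs), full houses or diamonds. *)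

(* Defs.v *)
From mathcomp Require Import all_boot all_order all_algebra.
From mathcomp Require Import complex polyrcf.

Set Implicit Arguments.
Unset Strict Implicit.
Unset Printing Implicit Defensive.

Import Order.TTheory GRing.Theory Num.Theory.

Record sgraph := SGraph {
  vertex :> finType;
  edge : rel vertex;
  edge_sym : symmetric edge;
  edge_irrefl : irreflexive edge }.

Notation "x -- y" := (edge x y) (at level 30).

Section Graphs.
Variable G : sgraph.
Implicit Types (x y u v : G) (S : {set G}).

Definition connected := forall x y, connect (@edge G) x y.

(* Some path of length n (n edges, no repeated vertex) joins x to y. *)
Definition joined_by_path x y (n : nat) :=
  [exists p : n.-tuple G,
    [&& path (@edge G) x p, last x p == y & uniq (x :: p)]].

(* The least length of a path from x to y; such a length is always smaller
   than #|G|, which is therefore the value taken when there is no path. *)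
Definition dist x y : nat := find (joined_by_path x y) (iota 0 #|G|).

Definition diam : nat := \max_(x : G) \max_(y : G) dist x y.

(* Adjacency in G - S. *)
Definition edge_avoiding S : rel G :=
  [rel x y | [&& x \notin S, y \notin S & x -- y]].

Definition separator u v S :=
  [&& u \notin S, v \notin S & ~~ connect (edge_avoiding S) u v].

Definition minimal_vertex_separator S :=
  exists u v, [/\ u != v, ~~ (u -- v) & minset (separator u v) S].

(* Meant for connected G: removing x disconnects G. *)
Definition cut_vertex x := exists u v, separator u v [set x].

Definition universal_vertex x := forall y, y != x -> x -- y.

Definition complete := forall x y, x != y -> x -- y.

End Graphs.

Definition isomorphic (G H : sgraph) :=
  exists2 f : G -> H, bijective f & forall x y, (f x -- f y) = (x -- y).

(* Subgraphs need not be induced. *)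
Record subgraph (G : sgraph) := Subgraph {
  sub_vertices : {set G};
  sub_edge : rel G;
  sub_edge_sym : symmetric sub_edge;
  sub_edgeP : forall x y, sub_edge x y ->
    [/\ x \in sub_vertices, y \in sub_vertices & x -- y] }.

Section SubgraphGraph.
Variables (G : sgraph) (K : subgraph G).

Let T : finType := {x : G | x \in sub_vertices K}.
Let e : rel T := relpre val (sub_edge K).

Fact subgraph_edge_sym : symmetric e.
Proof. by move=> x y; apply: sub_edge_sym. Qed.

Fact subgraph_edge_irrefl : irreflexive e.
Proof. by move=> x; apply/negP => /sub_edgeP[_ _]; rewrite edge_irrefl. Qed.

Definition graph_of_subgraph : sgraph :=
  SGraph subgraph_edge_sym subgraph_edge_irrefl.

End SubgraphGraph.

Coercion graph_of_subgraph : subgraph >-> sgraph.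

Section Induced.
Variables (G : sgraph) (A : {set G}).

Let e : rel G := [rel x y | [&& x \in A, y \in A & x -- y]].

Fact induced_sym : symmetric e.
Proof. by move=> x y; rewrite /e /= edge_sym andbCA. Qed.

Fact inducedP x y : e x y -> [/\ x \in A, y \in A & x -- y].
Proof. by move/and3P. Qed.

Definition induced : subgraph G := Subgraph induced_sym inducedP.

End Induced.

Definition subgraph_le (G : sgraph) (K L : subgraph G) :=
  sub_vertices K \subset sub_vertices L /\ subrel (sub_edge K) (sub_edge L).

Definition nonseparable (G : sgraph) :=
  connected G /\ forall x : G, ~ cut_vertex x.

Definition block (G : sgraph) (K : subgraph G) :=
  nonseparable K /\
  forall L : subgraph G, nonseparable L -> subgraph_le K L -> subgraph_le L K.

(* The missing edge is {2, 3}. *)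
Definition diamond_edge : rel 'I_4 :=
  [rel i j : 'I_4 | (i != j) && ~~ ((1 < i) && (1 < j))].

Fact diamond_sym : symmetric diamond_edge.
Proof.
by move=> i j; rewrite /diamond_edge /= eq_sym [(1 < i) && _]andbC.
Qed.

Fact diamond_irrefl : irreflexive diamond_edge.
Proof. by move=> i; rewrite /diamond_edge /= eqxx. Qed.

Definition diamond : sgraph := SGraph diamond_sym diamond_irrefl.

(* A K_4 on 0, 1, 2, 3, and the vertex 4 adjacent to 0 and 1 only. *)
Definition full_house_edge : rel 'I_5 :=
  [rel i j : 'I_5 | [&& i != j, (i == 4 :> nat) ==> (j < 2)
                       & (j == 4 :> nat) ==> (i < 2)]].

Fact full_house_sym : symmetric full_house_edge.
Proof.
by move=> i j; rewrite /full_house_edge /= eq_sym; congr (_ && _); apply: andbC.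
Qed.

Fact full_house_irrefl : irreflexive full_house_edge.
Proof. by move=> i; rewrite /full_house_edge /= eqxx. Qed.

Definition full_house : sgraph := SGraph full_house_sym full_house_irrefl.

Definition relaxed_block_star (G : sgraph) :=
  [/\ connected G,
      exists x : G, universal_vertex x,
      exists2 S : {set G}, minimal_vertex_separator S & #|S| = 2
    & forall K : subgraph G, block K ->
        [\/ complete K, isomorphic K full_house | isomorphic K diamond]].

Local Open Scope ring_scope.

(* The eigenvalues in R of A, repeated according to their multiplicity as
   roots of the characteristic polynomial, in nonincreasing order; for a
   symmetric A these are all n of them (char_poly_spectrum below). *)
Definition spectrum (R : rcfType) n (A : 'M[R]_n) : seq R :=
  let p := char_poly A in
  sort >=%O (flatten [seq nseq (mup x p) x | x <- rootsR p]).

(* The order of the vertices is that of enum G. *)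
Definition distance_matrix (R : rcfType) (G : sgraph) : 'M[R]_#|G| :=
  \matrix_(i, j) (dist (enum_val i) (enum_val j))%:R.

(* Second largest eigenvalue (sequence indices start at 0); only meaningful
   when G has at least two vertices. *)
Definition lambda2 (R : rcfType) (G : sgraph) : R :=
  (spectrum (distance_matrix R G))`_1.

Lemma char_poly_conj (F : fieldType) n (P A B : 'M[F]_n) :
  P \in unitmx -> P *m A = B *m P -> char_poly A = char_poly B.
Proof.
move=> unitP PAB.
have PX : map_mx polyC P *m char_poly_mx A = char_poly_mx B *m map_mx polyC P.
  by rewrite /char_poly_mx mulmxBr mulmxBl scalar_mxC -!map_mxM PAB.
have detP : \det (map_mx polyC P) != 0.
  by rewrite det_map_mx polyC_eq0 -unitfE -unitmxE.
by apply: (mulfI detP); rewrite /char_poly -det_mulmx PX det_mulmx mulrC.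
Qed.

Lemma symmetric_char_poly_split (R : rcfType) n (A : 'M[R]_n) : A^T = A ->
  exists s : seq R, char_poly A = \prod_(x <- s) ('X - x%:P).
Proof.
move=> symA; pose B : 'M[R[i]]_n := map_mx (real_complex R) A.
have realB : B \is a mxOver Num.real.
  by apply/mxOverP => i j; rewrite mxE; apply/complex_realP; exists (A i j).
have hermB : B \is hermsymmx.
  apply: realsym_hermsym => //; apply/is_hermitianmxP.
  by rewrite expr0 scale1r map_mx_id // /B map_trmx symA.
have normB := hermitian_normalmx hermB.
have /mxOverP real_d := hermitian_spectral_diag_real hermB.
have := orthomx_spectralP normB.
set P := spectralmx B; set d := spectral_diag B => defB.
have unitP : P \in unitmx := spectral_unit B.
have charB : char_poly B = char_poly (diag_mx d).
  apply: (char_poly_conj unitP); rewrite {1}defB !mulmxA mulmxV //.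
  by rewrite mul1mx.
exists [seq complex.Re (d ord0 i) | i <- enum 'I_n].
apply: (map_poly_inj (real_complex R)).
rewrite map_char_poly -/B charB char_poly_trig ?diag_mx_is_trig //.
rewrite rmorph_prod big_map big_enum /=; apply: eq_bigr => i _.
rewrite mxE eqxx mulr1n rmorphB /= map_polyX map_polyC /=.
by rewrite (RRe_real (real_d ord0 i)).
Qed.

Lemma spectrum_sorted (R : rcfType) n (A : 'M[R]_n) :
  sorted >=%O (spectrum A).
Proof. by apply: sort_sorted => x y; apply: ge_total. Qed.

Lemma char_poly_spectrum (R : rcfType) n (A : 'M[R]_n) : A^T = A ->
  char_poly A = \prod_(x <- spectrum A) ('X - x%:P).
Proof.
move=> /symmetric_char_poly_split[s defp].
have p_neq0 : char_poly A != 0 by rewrite monic_neq0 ?char_poly_monic.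
rewrite {1}defp; apply: perm_big; rewrite /spectrum perm_sym perm_sort.
have uniq_roots : uniq (rootsR (char_poly A)).
  exact/(sorted_uniq lt_trans ltxx)/sorted_roots.
apply/allP => x _ /=; rewrite count_flatten -map_comp.
rewrite (eq_map (g := fun y => (y == x) * mup y (char_poly A))%N); last first.
  by move=> y; rewrite /= count_nseq.
rewrite sumnE big_map -mu_prod_XsubC -defp.
have [x_root|x_nroot] := boolP (x \in rootsR (char_poly A)).
  rewrite (bigD1_seq x) //= eqxx mul1n big1 ?addn0 // => y /negPf->.
  by rewrite mul0n.
rewrite mupNroot; last by move: x_nroot; rewrite -(roots_on_rootsR p_neq0).
rewrite big_seq big1 // => y y_root; case: eqP => [eq_yx|]; rewrite ?mul0n //.
by rewrite -eq_yx y_root in x_nroot.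
Qed.

(* Main.v *)
(* In a graph of diameter 2, D + 1/2 = 2J - (A + 3/2), and lambda2 < -1/2 says
   that no plane carries a positive semidefinite restriction of this form,
   even for the rows and columns of an induced, possibly disconnected,
   subgraph. This excludes induced paths P4 and cycles C4, so G is trivially
   perfect and, being connected, has a universal vertex v; thus G itself is the
   relaxed block star. Restricting the form to the orthogonal of e_v shows that
   A + 3/2 is positive definite on every neighbourhood, which excludes there
   the claw, the diamond, the butterfly and K4 with a pendant edge. The
   components of G - v are then cliques, P3's or paws, and the blocks of G are
   the cones over them: cliques, diamonds and full houses. *)

Require Import Defs.
From mathcomp Require Import all_boot all_order all_algebra.
From mathcomp Require Import complex ring lra.

Set Implicit Arguments.
Unset Strict Implicit.
Unset Printing Implicit Defensive.

Import Order.TTheory GRing.Theory Num.Theory.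
Local Open Scope ring_scope.

(** * The second eigenvalue and positive semidefinite planes *)

(** A real symmetric matrix is Hermitian over [R[i]], so unitary coordinates turn its form into a
    sum of squared moduli with real weights. The coordinates may be complex, hence the conjugate. *)
Lemma symmetric_spectral_form (R : rcfType) n (A : 'M[R]_n) : A^T = A ->
  exists2 P : 'M[R[i]]_n, P \in unitmx & exists2 d : 'I_n -> R,
    perm_eq [seq d i | i <- enum 'I_n] (spectrum A)
  & forall (c : R) (u : 'rV[R[i]]_n),
      (u *m map_mx (real_complex R) (A - c%:M) *m map_mx Num.conj u^T) 0 0
      = \sum_i (real_complex R (d i - c)) * `|(u *m P) 0 i| ^+ 2.
Proof.
move=> symA; pose B : 'M[R[i]]_n := map_mx (real_complex R) A.
have realB : B \is a mxOver Num.real.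
  by apply/mxOverP => i j; rewrite mxE; apply/complex_realP; exists (A i j).
have hermB : B \is hermsymmx.
  apply: realsym_hermsym => //; apply/is_hermitianmxP.
  by rewrite expr0 scale1r map_mx_id // /B map_trmx symA.
have normB := hermitian_normalmx hermB.
have /mxOverP real_d := hermitian_spectral_diag_real hermB.
have := orthomx_spectralP normB.
set S := spectralmx B; set d := spectral_diag B => defB.
have unitS : S \in unitmx := spectral_unit B.
have unitaryS : S \is unitarymx := spectral_unitarymx B.
have ReE i : real_complex R (complex.Re (d ord0 i)) = d ord0 i.
  by rewrite (RRe_real (real_d ord0 i)).
exists (invmx S); first by rewrite unitmx_inv.
exists (fun i => complex.Re (d ord0 i)).
  apply: prod_XsubC_eq; rewrite -char_poly_spectrum //.
  apply: (map_poly_inj (real_complex R)).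
  have charB : char_poly B = char_poly (diag_mx d).
    apply: (char_poly_conj unitS); rewrite {1}defB !mulmxA mulmxV //.
    by rewrite mul1mx.
  rewrite map_char_poly -/B charB char_poly_trig ?diag_mx_is_trig //.
  rewrite rmorph_prod big_map big_enum /=; apply: eq_bigr => i _.
  by rewrite mxE eqxx mulr1n rmorphB /= map_polyX map_polyC /= ReE.
move=> c u; set w := u *m invmx S.
have wE : map_mx Num.conj w^T = S *m map_mx Num.conj u^T.
  rewrite /w trmx_mul map_mxM invmx_unitary //; congr (_ *m _).
  apply/matrixP => i j; rewrite !mxE; apply: conjCK.
have -> : map_mx (real_complex R) (A - c%:M)
    = invmx S *m (diag_mx d - (real_complex R c)%:M) *m S.
  rewrite map_mxB map_scalar_mx /= -/B {1}defB mulmxBr mulmxBl -mulmxA; congr (_ - _).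
  by rewrite mul_mx_scalar -scalemxAl mulVmx // scalemx1.
rewrite !mulmxA -/w -mulmxA -wE mulmxBr mulmxBl mul_mx_scalar -scalemxAl.
rewrite mul_mx_diag !mxE mulr_sumr -sumrB; apply: eq_bigr => i _.
by rewrite !mxE normCK rmorphB /= ReE; ring.
Qed.

(** The spectrum is nonincreasing, so only its first entry can reach [c]. With fewer than two
    entries the second one is the default 0, and the bound is then just the size. *)
Lemma spectrum_nth1_count (R : rcfType) n (A : 'M[R]_n) (c : R) :
  (spectrum A)`_1 < c -> (count (fun x => (c <= x)%R) (spectrum A) <= 1)%N.
Proof.
have := spectrum_sorted A; case: (spectrum A) => [|x [|y s]] //=.
  by move=> _ _; rewrite addn0; apply: leq_b1.
case/andP=> _ ys ltyc; have := ys.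
rewrite (path_sortedE (rev_trans le_trans)) => /andP[/allP ley _].
rewrite [c <= y]leNgt ltyc add0n.
suff /eqP-> : count (fun z => c <= z) s == 0%N by rewrite addn0 leq_b1.
rewrite -leqn0 leqNgt -has_count -all_predC; apply/allP => z /ley /= lezy.
by rewrite -ltNge (le_lt_trans lezy).
Qed.

(** At most one spectral coordinate has a nonnegative weight, and the form is negative definite on
    the hyperplane where that coordinate vanishes. A plane spanned by [f] and [g] would meet this
    hyperplane. *)
Lemma second_eigenvalue_form (R : rcfType) n (A : 'M[R]_n) (c : R)
    (f g : 'rV[R]_n) : A^T = A -> (spectrum A)`_1 < c ->
  0 < (f *m (A - c%:M) *m f^T) 0 0 -> (f *m (A - c%:M) *m g^T) 0 0 = 0 ->
  0 <= (g *m (A - c%:M) *m g^T) 0 0 -> g = 0.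
Proof.
move=> symA ltc; have [P unitP [d permd formE]] := symmetric_spectral_form symA.
set Q := A - c%:M => Qff Qfg Qgg; apply/eqP/negPn/negP => g_neq0.
have symQ : Q^T = Q by rewrite /Q linearB /= symA tr_scalar_mx.
have Qgf : (g *m Q *m f^T) 0 0 = 0.
  rewrite -Qfg -[in RHS]mulmxA -[Q in RHS]symQ -trmx_mul -[X in _ = (X *m _) _ _]trmxK.
  by rewrite -trmx_mul [RHS]mxE.
pose r : {rmorphism R -> R[i]} := real_complex R.
pose f' := map_mx r f; pose g' := map_mx r g.
have [j gj] : exists j, g 0 j != 0.
  by apply/existsP; apply: contraNT g_neq0 => /existsPn g0; apply/eqP/rowP => j;
     rewrite mxE; apply/eqP/negPn/g0.
(* If every weight is negative, any index will do; [j] is at hand because [g] is nonzero. *)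
have [i0 di0] : exists i0, forall i, i != i0 -> d i < c.
  case: (pickP (fun i => c <= d i)) => [i0 ci0 | dlt]; last first.
    by exists j => i _; rewrite ltNge dlt.
  exists i0 => i i_neq; rewrite ltNge; apply/negP => ci.
  have := spectrum_nth1_count ltc; rewrite -(permP permd) count_map.
  rewrite -sum1_count big_enum_cond sum1_card => /card_le1_eqP/(_ i i0).
  by move=> /(_ ci ci0)/esym/eqP; rewrite (negPf i_neq).
have formQ (h : 'rV[R[i]]_n) : (h *m map_mx r Q *m map_mx Num.conj h^T) 0 0
    = \sum_i r (d i - c) * `|(h *m P) 0 i| ^+ 2 by exact: formE.
have form_le (h : 'rV[R[i]]_n) : (h *m P) 0 i0 = 0 ->
    (h *m map_mx r Q *m map_mx Num.conj h^T) 0 0 <= 0.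
  move=> h0; rewrite formQ; apply: sumr_le0 => i _.
  have [->|/di0 dlt] := eqVneq i i0; first by rewrite h0 normr0 expr0n mulr0.
  by rewrite mulr_le0_ge0 ?exprn_ge0 // -(rmorph0 r) lecR subr_le0 ltW.
have conjr m (h : 'rV[R]_m) : map_mx Num.conj (map_mx r h)^T = map_mx r h^T.
  apply/matrixP => i k; rewrite !mxE conj_Creal //.
  by apply/complex_realP; exists (h k i).
have mapform (h k : 'rV[R]_n) :
    (map_mx r h *m map_mx r Q *m map_mx r k^T) 0 0 = r ((h *m Q *m k^T) 0 0).
  by rewrite -!map_mxM mxE.
(* If [g] lies in the hyperplane, its form is both nonpositive and nonnegative, so every term
   vanishes; the weights off [i0] being negative, all coordinates of [g] vanish. *)
have [gP0|gP0] := eqVneq ((g' *m P) 0 i0) 0.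
  have Qgg0 : \sum_i r (d i - c) * `|(g' *m P) 0 i| ^+ 2 = 0.
    rewrite -formQ; apply/eqP; rewrite eq_le form_le // conjr mapform.
    by rewrite -(rmorph0 r) lecR.
  have /matrixP/(_ 0 j)/eqP : g' = 0.
    apply: (can_inj (mulmxK unitP)); rewrite mul0mx; apply/rowP => i.
    rewrite [RHS]mxE; have [->//|/di0 dlt] := eqVneq i i0.
    have := @psumr_eq0P _ _ predT (fun i => - (r (d i - c) * `|(g' *m P) 0 i| ^+ 2)).
    rewrite sumrN Qgg0 oppr0 => /(_ _ erefl i isT)/eqP.
    rewrite oppr_eq0 mulf_eq0 fmorph_eq0 subr_eq0 (lt_eqF dlt) sqrf_eq0 normr_eq0.
    move=> H; apply/eqP/H => k _; rewrite oppr_ge0.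
    have [->|/di0 dltk] := eqVneq k i0; first by rewrite gP0 normr0 expr0n mulr0.
    by rewrite mulr_le0_ge0 ?exprn_ge0 // -(rmorph0 r) lecR subr_le0 ltW.
  by rewrite !mxE fmorph_eq0 (negPf gj).
(* This [z] puts [f' - z *: g'] in the hyperplane. By orthogonality its form is that of [f] plus
   [|z| ^ 2] times that of [g], which is positive. *)
pose z := (f' *m P) 0 i0 / (g' *m P) 0 i0.
have := form_le (f' - z *: g'); rewrite mulmxBl -scalemxAl.
move: ((f' *m P)) ((g' *m P)) @z gP0 => a b z b_neq0.
rewrite mxE [X in _ + X]mxE [X in _ - X]mxE mulfVK // subrr => /(_ erefl).
have -> : map_mx Num.conj (f' - z *: g')^T = map_mx r f^T - Num.conj z *: map_mx r g^T.
  rewrite -!conjr; apply/matrixP => i k; rewrite !mxE rmorphB rmorphM //.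
rewrite !(mulmxBl, mulmxBr) -?(scalemxAl, scalemxAr).
have entry X Y W V (t w : R[i]) :
    (X - t *: Y - (w *: W - t *: (w *: V)) : 'M_1) 0 0
    = X 0 0 - t * Y 0 0 - (w * W 0 0 - t * (w * V 0 0)) by rewrite !mxE.
rewrite entry !mapform Qfg Qgf rmorph0 !mulr0 subr0 sub0r opprK mulrA -normCK.
rewrite lt_geF // ltr_pwDl ?mulr_ge0 ?exprn_ge0 //.
  by rewrite -(rmorph0 r) ltcR.
by rewrite -(rmorph0 r) lecR.
Qed.

(** * Distances and the form [D + 1/2] in diameter 2 *)

Lemma edge_neq (G : sgraph) (x y : G) : x -- y -> (x == y) = false.
Proof. by move=> xy; apply: contraTF xy => /eqP ->; rewrite edge_irrefl. Qed.

Ltac graph_rewrite :=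
  repeat match goal with
  | H : is_true (edge ?x ?y) |- context [edge ?x ?y] => rewrite H
  | H : is_true (edge ?x ?y) |- context [edge ?y ?x] => rewrite (edge_sym y x) H
  | H : is_true (~~ edge ?x ?y) |- context [edge ?x ?y] => rewrite (negPf H)
  | H : is_true (~~ edge ?x ?y) |- context [edge ?y ?x] =>
      rewrite (edge_sym y x) (negPf H)
  | H : is_true (edge ?x ?y) |- context [?x == ?y] => rewrite (edge_neq H)
  | H : is_true (edge ?x ?y) |- context [?y == ?x] => rewrite (eq_sym y x) (edge_neq H)
  | H : is_true (?x != ?y) |- context [?x == ?y] => rewrite (negPf H)
  | H : is_true (?x != ?y) |- context [?y == ?x] => rewrite (eq_sym y x) (negPf H)
  end.

Lemma joined_by_path0 (G : sgraph) (x y : G) : joined_by_path x y 0 = (x == y).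
Proof.
apply/existsP/eqP => [[p]|->]; first by rewrite tuple0 /= => /andP[/eqP].
by exists [tuple]; rewrite /= eqxx.
Qed.

Lemma joined_by_path1 (G : sgraph) (x y : G) : joined_by_path x y 1 = x -- y.
Proof.
apply/existsP/idP => [[p]|xy].
  case: p => -[|z [|? ?]] //= Hp; rewrite andbT.
  by case/and3P=> xz /eqP <-.
exists [tuple y]; rewrite /= xy eqxx /= inE andbT.
by apply: contraTneq xy => ->; rewrite edge_irrefl.
Qed.

Lemma distxx (G : sgraph) (x : G) : dist x x = 0%N.
Proof.
have : (0 < #|G|)%N by apply/card_gt0P; exists x.
by rewrite /dist; case: #|G| => [|n] //= _; rewrite joined_by_path0 eqxx.
Qed.

Lemma dist_diam2 (G : sgraph) (x y : G) : diam G = 2%N ->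
  dist x y = if x == y then 0%N else if x -- y then 1%N else 2%N.
Proof.
move=> diamG; case: eqVneq => [->|x_neq_y]; first exact: distxx.
have dist_le2 : (dist x y <= 2)%N.
  rewrite -diamG; apply: leq_trans (leq_bigmax x).
  exact: (leq_bigmax (F := fun z => dist x z) y).
(* Two vertices ensure that the search list contains the lengths 0 and 1. When both fail, [find]
   returns at least 2, and [dist_le2] gives equality. *)
have : (1 < #|G|)%N by apply/card_gt1P; exists x, y.
move: dist_le2; rewrite /dist; case: #|G| => [|[|n]] //=.
rewrite joined_by_path0 joined_by_path1 (negPf x_neq_y).
by case: (x -- y) => //; case: (find _ _).
Qed.

(** Test vectors are lists of weighted vertices, so that their forms expand by [big_cons]; the
    weights of a repeated vertex add up. *)
Definition vertex_comb (R : rcfType) (G : sgraph) (s : seq (G * R)) : 'rV[R]_#|G| :=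
  \sum_(p <- s) p.2 *: delta_mx 0 (enum_rank p.1).

Lemma vertex_combE (R : rcfType) (G : sgraph) (s : seq (G * R)) (x : G) :
  vertex_comb s 0 (enum_rank x) = \sum_(p <- s | p.1 == x) p.2.
Proof.
rewrite summxE [RHS]big_mkcond; apply: eq_bigr => p _.
rewrite !mxE eqxx (inj_eq enum_rank_inj) eq_sym.
by case: eqP => _; rewrite ?mulr1 ?mulr0.
Qed.

(* Entries of [D + 1/2] for a graph of diameter at most 2. *)
Definition diam2_coef (R : rcfType) (G : sgraph) (x y : G) : R :=
  if x == y then 1 / 2 else if x -- y then 1 else 2.

Lemma vertex_comb_form (R : rcfType) (G : sgraph) (s t : seq (G * R)) :
  diam G = 2%N ->
  (vertex_comb s *m (distance_matrix R G - (- (1 / 2))%:M) *m (vertex_comb t)^T) 0 0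
  = \sum_(p <- s) \sum_(q <- t) p.2 * q.2 * diam2_coef R p.1 q.1.
Proof.
move=> diamG; rewrite /vertex_comb !mulmx_suml summxE; apply: eq_bigr => p _.
rewrite linear_sum mulmx_sumr summxE; apply: eq_bigr => q _.
rewrite linearZ /= -!scalemxAl -scalemxAr !mxE mulrA; congr (_ * _).
rewrite -rowE (bigD1 (enum_rank q.1)) //= !mxE !eqxx mulr1 big1 => [|i /negPf ne].
  rewrite !enum_rankK dist_diam2 // (inj_eq enum_rank_inj) addr0 /diam2_coef.
  by case: eqP => _ /=; [rewrite mulr1n; lra | case: (p.1 -- q.1); rewrite mulr0n subr0].
by rewrite !mxE ne andbF mulr0.
Qed.

Lemma distance_matrix_sym (R : rcfType) (G : sgraph) :
  diam G = 2%N -> (distance_matrix R G)^T = distance_matrix R G.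
Proof.
move=> diamG; apply/matrixP => i j; rewrite !mxE !dist_diam2 //.
by rewrite edge_sym eq_sym.
Qed.

(** * Forbidden induced subgraphs and dominating vertices *)

(** If [b] and [d] were not adjacent, the four vertices would induce a P4 or a C4, according to
    [a -- d]. The constant and the alternating vectors then span a positive semidefinite plane. *)
Lemma no_P4_C4 (R : rcfType) (G : sgraph) (a b c d : G) :
  diam G = 2%N -> lambda2 R G < - (1 / 2) ->
  a -- b -> b -- c -> c -- d -> a != c -> b != d -> ~~ (a -- c) -> b -- d.
Proof.
move=> diamG lam ab bc cd a_neq_c b_neq_d nac; apply/negPn/negP => nbd.
have a_neq_d : a != d.
  by apply: contraNneq nac => ->; rewrite edge_sym.
pose f : seq (G * R) := [:: (a, 1); (b, 1); (c, 1); (d, 1)].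
pose g : seq (G * R) := [:: (a, 1); (b, -1); (c, 1); (d, -1)].
have := second_eigenvalue_form (f := vertex_comb f) (g := vertex_comb g)
  (distance_matrix_sym R diamG) lam.
rewrite !vertex_comb_form // /f /g !big_cons !big_nil /diam2_coef /= !eqxx.
graph_rewrite; rewrite [d -- a]edge_sym.
(* Here [x] is 1 for C4 and 2 for P4. The forms of [f] and [g] are [16 + 2 x] and [4 - 2 x], and [f]
   and [g] are orthogonal for both values. *)
have [x [-> xr]] : exists x : R, (if a -- d then 1 else 2) = x /\ 1 <= x <= 2.
  by case: (a -- d); eexists; split; [reflexivity|lra|reflexivity|lra].
move=> /(_ _ _ _)/matrixP/(_ 0 (enum_rank a)); rewrite vertex_combE mxE.
rewrite !big_cons big_nil /= eqxx; graph_rewrite.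
move=> H; have : 1 + 0 = 0 :> R by apply: H; lra.
lra.
Qed.

(* The combinations [t - 2 (sum of t) e_v] are orthogonal to [e_v] for [D + 1/2],
   which is minus [A + 3/2] on them. *)
Lemma neighborhood_form_gt0 (R : rcfType) (G : sgraph) (v : G) (t : seq (G * R)) (x : G) :
  diam G = 2%N -> lambda2 R G < - (1 / 2) ->
  all (fun p => v -- p.1) t -> \sum_(p <- t | p.1 == x) p.2 != 0 ->
  0 < \sum_(p <- t) \sum_(q <- t) p.2 * q.2 *
        (if p.1 == q.1 then 3 / 2 else (p.1 -- q.1)%:R).
Proof.
move=> diamG lam /allP vt tx; rewrite ltNge; apply/negP => le0.
pose sigma := \sum_(p <- t) p.2.
have neq p : p \in t -> (v == p.1) = false.
  by move/vt; apply: contraTF => /eqP <-; rewrite edge_irrefl.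
have rowv : \sum_(p <- t) p.2 * diam2_coef R v p.1 = sigma.
  by apply: eq_big_seq => p tp; rewrite /diam2_coef neq // vt // mulr1.
pose f : seq (G * R) := [:: (v, 1)]; pose g := (v, - 2 * sigma) :: t.
have : vertex_comb g = 0.
  apply: (second_eigenvalue_form (f := vertex_comb f) (distance_matrix_sym R diamG) lam).
  - by rewrite vertex_comb_form // !big_cons !big_nil /diam2_coef eqxx /=; lra.
  - rewrite vertex_comb_form // !big_cons !big_nil /= {1}/diam2_coef eqxx.
    under eq_bigr do rewrite mul1r.
    by rewrite rowv; lra.
  (* Once the entries among neighbours are written as 2 minus those of [A + 3/2], the multiples of
     [sigma ^ 2] are 2 from [v], -4 from the cross terms and 2 from the constant part; they
     cancel. *)
  rewrite vertex_comb_form // big_cons /= big_cons /= {1}/diam2_coef eqxx.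
  under eq_bigr do rewrite -mulrA.
  rewrite -mulr_sumr rowv.
  under [X in _ + X]eq_big_seq => p tp.
    rewrite big_cons /= {1}/diam2_coef eq_sym neq // edge_sym vt // mulr1.
    under eq_bigr => q _.
      have -> : p.2 * q.2 * diam2_coef R p.1 q.1 = 2 * p.2 * q.2
         - p.2 * q.2 * (if p.1 == q.1 then 3 / 2 else (p.1 -- q.1)%:R).
        by rewrite /diam2_coef; case: eqP => _; [lra | case: edge; rewrite /=; lra].
      over.
    rewrite sumrB -mulr_sumr -/sigma.
    over.
  by rewrite big_split /= sumrB -!mulr_suml -mulr_sumr -/sigma; lra.
(* The coefficient of [g] at [x] contradicts [tx]: away from [v] it is the sum in [tx], and at [v]
   that sum is empty. *)
move/matrixP/(_ 0 (enum_rank x)); rewrite vertex_combE mxE big_cons /=.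
case: eqP => [vx|_] /eqP; last by rewrite (negPf tx).
move: tx; rewrite -vx big_seq_cond big_pred0 ?eqxx // => p.
by apply/negP => /andP[/neq + /eqP pv]; rewrite pv eqxx.
Qed.

(** The weights [t] must make the form of [A + 3/2] nonpositive; [x] is a vertex of nonzero weight.
    The form takes the value -3/2 on the claw below, and exactly 0 in the other three cases, where
    strict positivity is essential. *)
Ltac forbidden_form v t x :=
  let lt0 := fresh in
  have lt0 := @neighborhood_form_gt0 _ _ v t x;
  move: lt0; rewrite !big_cons !big_nil /= !eqxx; graph_rewrite; rewrite /= => lt0;
  match goal with H : diam _ = _, H' : is_true (lambda2 _ _ < _) |- _ =>
    move: (lt0 H H' isT) end; lra.

Lemma neighborhood_no_claw (R : rcfType) (G : sgraph) (v w x y z : G) :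
  diam G = 2%N -> lambda2 R G < - (1 / 2) ->
  v -- w -> v -- x -> v -- y -> v -- z -> w -- x -> w -- y -> w -- z ->
  x != y -> x != z -> y != z -> ~~ (x -- y) -> ~~ (x -- z) -> y -- z.
Proof.
move=> diamG lam vw vx vy vz wx wy wz x_y x_z y_z nxy nxz.
apply/negPn/negP => nyz.
forbidden_form v [:: (w, -2 : R); (x, 1); (y, 1); (z, 1)] w.
Qed.

Lemma neighborhood_no_diamond (R : rcfType) (G : sgraph) (v w z x y : G) :
  diam G = 2%N -> lambda2 R G < - (1 / 2) ->
  v -- w -> v -- x -> v -- y -> v -- z ->
  w -- z -> w -- x -> w -- y -> z -- x -> z -- y -> x != y -> x -- y.
Proof.
move=> diamG lam vw vx vy vz wz wx wy zx zy x_y; apply/negPn/negP => nxy.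
forbidden_form v [:: (w, -1 : R); (z, -1); (x, 1); (y, 1)] w.
Qed.

Lemma neighborhood_no_butterfly (R : rcfType) (G : sgraph) (v w x x' y y' : G) :
  diam G = 2%N -> lambda2 R G < - (1 / 2) ->
  v -- w -> v -- x -> v -- x' -> v -- y -> v -- y' ->
  w -- x -> w -- x' -> w -- y -> w -- y' -> x -- x' -> y -- y' ->
  x != y -> x != y' -> x' != y -> x' != y' ->
  ~~ (x -- y) -> ~~ (x -- y') -> ~~ (x' -- y) -> x' -- y'.
Proof.
move=> diamG lam vw vx vx' vy vy' wx wx' wy wy' xx' yy' x_y x_y' x'_y x'_y'.
move=> nxy nxy' nx'y; apply/negPn/negP => nx'y'.
forbidden_form v [:: (w, -2 : R); (x, 1); (x', 1); (y, 1); (y', 1)] w.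
Qed.

Lemma neighborhood_no_K4_pendant (R : rcfType) (G : sgraph) (v w x y z p : G) :
  diam G = 2%N -> lambda2 R G < - (1 / 2) ->
  v -- w -> v -- x -> v -- y -> v -- z -> v -- p ->
  w -- x -> w -- y -> w -- z -> w -- p -> x -- y -> x -- z -> y -- z ->
  x != p -> y != p -> z != p -> ~~ (x -- p) -> ~~ (y -- p) -> z -- p.
Proof.
move=> diamG lam vw vx vy vz vp wx wy wz wp xy xz yz x_p y_p z_p nxp nyp.
apply/negPn/negP => nzp.
(* The squares contribute [3/2 * 16 = 24] and the edges [2 * (3 - 15) = -24]. *)
forbidden_form v [:: (w, -3 : R); (x, 1); (y, 1); (z, 1); (p, 2)] w.
Qed.

(* A vertex of maximal degree in a component dominates it. *)
Lemma P4_C4_free_dominating (T : finType) (e : rel T) (x0 : T) :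
  symmetric e -> irreflexive e ->
  (forall a b c d, e a b -> e b c -> e c d -> a != c -> b != d ->
     ~~ e a c -> e b d) ->
  exists2 w, connect e x0 w & forall y, connect e x0 y -> y != w -> e w y.
Proof.
move=> sym_e irr_e freeP.
have [w x0w max_w] := arg_maxnP (fun w => #|[set z | e w z]|) (connect0 e x0).
exists w => // y x0y y_neq_w.
have wy : connect e w y.
  by apply: connect_trans x0y; rewrite (sym_connect_sym sym_e).
pose N : pred T := [pred z | (z == w) || e w z].
(* It suffices that the closed neighbourhood of [w] is stable under adjacency, since it then
   contains the whole component. *)
have closN : closed e N.
  apply: intro_closed; first exact: sym_connect_sym.
  move=> a b ab; rewrite !inE => /orP[/eqP <-|wa]; first by rewrite ab orbT.
  apply/orP; case: eqVneq => [|b_neq_w]; [by left|right].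
  apply/negPn/negP => nwb.
  (* Otherwise [a] is adjacent to [w], to [b] and to all other neighbours of [w], so its degree
     exceeds that of [w]. The path [d], [w], [a], [b] then contradicts [freeP]. *)
  have [d /andP[wd d_neq_a] nad] : exists2 d, e w d && (d != a) & ~~ e a d.
    apply/exists_inP; apply: contraT; rewrite negb_exists_in => /forall_inP h.
    have := max_w a (connect_trans x0w (connect1 wa)); rewrite /= leqNgt => /negP[].
    rewrite (cardsD1 a) inE wa add1n.
    apply: leq_trans (_ : #|w |: (b |: [set z | e w z] :\ a)| <= _)%N.
      by rewrite !cardsU1 !inE irr_e [w == b]eq_sym (negPf b_neq_w) (negPf nwb) !andbF.
    apply/subset_leq_card/subsetP => z; rewrite !inE.
    case/or3P=> [/eqP->|/eqP->|/andP[za wz]]; [by rewrite sym_e | by [] |].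
    by have := h z; rewrite wz za negbK => ->.
  have := freeP d w a b; rewrite sym_e wd wa ab d_neq_a eq_sym b_neq_w sym_e nad.
  by move=> /(_ isT isT isT isT isT isT); rewrite (negPf nwb).
have := closed_connect closN wy; rewrite !inE eqxx (negPf y_neq_w) /=.
by move=> <-.
Qed.

(** * Components dominated by a vertex *)

(** With [v] put in front, the listed orders match the vertex numberings of [diamond] and
    [full_house]. *)
Variant neighborhood_component_spec (G : sgraph) (w : G) (W : {set G}) : Prop :=
| CompClique of {in W &, forall x y, x != y -> x -- y}
| CompP3 x y of W =i [:: w; x; y] & w -- x & w -- y & x != y & ~~ (x -- y)
| CompPaw x z y of W =i [:: w; x; z; y] & w -- x & w -- z & w -- y & x -- z
    & x != y & z != y & ~~ (x -- y) & ~~ (z -- y).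

(** Given nonadjacent [x] and [y] in [W], any further vertex besides [w] is adjacent to exactly one
    of them: both would give a diamond, neither a claw. At most one such vertex can exist. *)
Lemma neighborhood_componentP (R : rcfType) (G : sgraph) (v w : G) (W : {set G}) :
  diam G = 2%N -> lambda2 R G < - (1 / 2) ->
  {in W, forall x, v -- x} -> w \in W -> {in W, forall x, x != w -> w -- x} ->
  neighborhood_component_spec w W.
Proof.
move=> diamG lam vW Ww wW.
have [/forall_inP cliqueW|] :=
    boolP [forall x in W, [forall y in W, (x != y) ==> x -- y]].
  by apply: CompClique => x y /cliqueW/forall_inP h /h/implyP.
rewrite negb_forall_in => /exists_inP[x Wx]; rewrite negb_forall_in.
case/exists_inP=> y Wy; rewrite negb_imply => /andP[x_y nxy].
have wx : w -- x.
  by apply: (wW) => //; apply: contraNneq nxy => xw; rewrite xw wW // -xw eq_sym.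
have wy : w -- y.
  by apply: (wW) => //; apply: contraNneq nxy => yw; rewrite yw edge_sym wW // -yw.
have not_both u : u \in W -> u != w -> u -- x -> ~~ (u -- y).
  move=> Wu u_w ux; apply/negP => uy; case/negP: nxy.
  have [vw vx vy vu] : [/\ v -- w, v -- x, v -- y & v -- u] by split; apply: vW.
  exact: (neighborhood_no_diamond diamG lam vw vx vy vu (wW _ Wu u_w)).
have one u : u \in W -> u != w -> u != x -> u != y -> u -- x \/ u -- y.
  move=> Wu u_w u_x u_y; apply/orP; apply: contraT; rewrite negb_or => /andP[nux nuy].
  have [vw vx vy vu] : [/\ v -- w, v -- x, v -- y & v -- u] by split; apply: vW.
  case/negP: nxy.
  exact: (neighborhood_no_claw diamG lam vw vu vx vy (wW _ Wu u_w) wx wy).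
(* Stated for an arbitrary nonadjacent pair, so that it also applies with [x] and [y] exchanged. *)
have paw x' y' z : x' \in W -> y' \in W ->
    w -- x' -> w -- y' -> x' != y' -> ~~ (x' -- y') ->
    (forall u, u \in W -> u != w -> u -- x' -> ~~ (u -- y')) ->
    (forall u, u \in W -> u != w -> u != x' -> u != y' -> u -- x' \/ u -- y') ->
    z \in W -> z != w -> z != y' -> z -- x' -> neighborhood_component_spec w W.
  move=> {Wx Wy wx wy x_y nxy not_both one x y}.
  move: x' y' => x y Wx Wy wx wy x_y nxy not_both one Wz z_w z_y zx.
  have nzy := not_both z Wz z_w zx.
  have wz := wW _ Wz z_w; have xz : x -- z by rewrite edge_sym.
  apply: (@CompPaw _ _ _ x z y) => // u.
  rewrite !inE; apply/idP/idP; last by case/or4P => /eqP->.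
  move=> Wu; apply: contraT; rewrite !negb_or => /and4P[u_w u_x u_z u_y].
  have wu := wW _ Wu u_w; have x_u : x != u by rewrite eq_sym.
  have z_u : z != u by rewrite eq_sym.
  have [vw vx vy vz vu] : [/\ v -- w, v -- x, v -- y, v -- z & v -- u].
    by split; apply: vW.
  (* A fifth vertex [u] on the side of [x] gives a K4 with pendant [y] or a diamond; on the side of
     [y] it gives a P4 on [x], [z], [u], [y] or a butterfly. *)
  case: (one u Wu u_w u_x u_y) => [ux|uy].
    have xu : x -- u by rewrite edge_sym.
    have nuy := not_both u Wu u_w ux.
    have [zu|nzu] := boolP (z -- u).
      by case/negP: nuy; apply: (neighborhood_no_K4_pendant diamG lam vw vx vz vu vy).
    by case/negP: nzu; apply: (neighborhood_no_diamond diamG lam vw vz vu vx).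
  have nux : ~~ (u -- x) by apply/negP => /(not_both u Wu u_w)/negP.
  have [zu|nzu] := boolP (z -- u).
    by case/negP: nzy; apply: (no_P4_C4 diamG lam xz zu uy); rewrite // edge_sym.
  have yu : y -- u by rewrite edge_sym.
  case/negP: nzu.
  by apply: (neighborhood_no_butterfly diamG lam vw vx vz vy vu); rewrite // edge_sym.
have [/exists_inP[z Wz /and3P[z_w z_x z_y]]|] :=
    boolP [exists z in W, [&& z != w, z != x & z != y]]; last first.
  rewrite negb_exists_in => /forall_inP h; apply: (@CompP3 _ _ _ x y) => // u.
  rewrite !inE; apply/idP/idP; last by case/or3P => /eqP->.
  by move/h; rewrite !negb_and !negbK.
case: (one z Wz z_w z_x z_y) => [zx|zy]; first exact: (paw x y z).
apply: (paw y x z) => //; first by rewrite eq_sym.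
- by rewrite edge_sym.
- by move=> u Wu u_w uy; apply/negP => /(not_both u Wu u_w)/negP.
- by move=> u Wu u_w u_y u_x; case: (one u Wu u_w u_x u_y); [right|left].
Qed.

(** * Blocks of a graph with a universal vertex *)

Lemma connect_homo (T T' : finType) (e : rel T) (e' : rel T') (f : T -> T') :
  {homo f : x y / e x y >-> e' x y} -> {homo f : x y / connect e x y >-> connect e' x y}.
Proof.
move=> homf x y /connectP[p + ->].
elim: p x => [|z p IHp] x /=; first by rewrite connect0.
by case/andP=> /homf/connect1 xz /IHp; apply: connect_trans.
Qed.

Lemma isomorphic_enum (n : nat) (e : rel 'I_n) (e_sym : symmetric e)
    (e_irrefl : irreflexive e) (G : sgraph) (K : subgraph G) (s : n.-tuple G) :
  uniq s -> sub_vertices K =i s ->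
  (forall i j, sub_edge K (tnth s i) (tnth s j) = e i j) ->
  isomorphic K (SGraph e_sym e_irrefl).
Proof.
move=> uniq_s Ks edgeE.
have lt_index (z : K) : (index (val z) s < n)%N.
  by rewrite -[X in (_ < X)%N](size_tuple s) index_mem -Ks (valP z).
have in_K i : tnth s i \in sub_vertices K by rewrite Ks mem_tnth.
pose f (z : K) := Ordinal (lt_index z).
have fE z : tnth s (f z) = val z.
  by rewrite (tnth_nth (val z)) nth_index // -Ks (valP z).
exists f => [|x y]; last by rewrite /edge /= -edgeE !fE.
exists (fun i => Sub (tnth s i) (in_K i) : K) => [z|i].
  by apply: val_inj; rewrite /= fE.
by apply: val_inj; rewrite /= (tnth_nth (tnth s i)) index_uniq ?size_tuple.
Qed.

(** For [x != v] this is the component of [x] in [G - v]; for [x = v] only reflexivity remains and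
    it is [[set v]]. *)
Definition component_avoiding (G : sgraph) (v x : G) : {set G} :=
  [set y | connect (edge_avoiding [set v]) x y].

Lemma edge_avoiding_sym (G : sgraph) (S : {set G}) : symmetric (edge_avoiding S).
Proof. by move=> x y; rewrite /edge_avoiding /= edge_sym andbCA. Qed.

Lemma component_avoiding_neq (G : sgraph) (v x y : G) :
  x != v -> y \in component_avoiding v x -> y != v.
Proof.
move=> x_v; rewrite inE.
have clos : closed (edge_avoiding [set v]) [pred z | z != v].
  move=> a b /and3P[av bv _]; move: av bv; rewrite !inE.
  by move=> -> ->.
by move/(closed_connect clos); rewrite !inE x_v => <-.
Qed.

(** Deleting a vertex other than [v] leaves [v] as a hub; deleting [v] leaves a component of
    [G - v], which is connected. *)
Lemma cone_nonseparable (G : sgraph) (v x : G) : universal_vertex v -> x != v ->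
  nonseparable (induced (v |: component_avoiding v x)).
Proof.
move=> univ x_v; set C := component_avoiding v x; set L := induced _.
have in_v : v \in v |: C by rewrite setU11.
pose v' : L := Sub v in_v.
have edgeE (a b : L) : a -- b = (val a -- val b).
  by rewrite {1}/edge /= (valP a) (valP b).
have to_v (a : L) : a != v' -> a -- v'.
  by rewrite -val_eqE edgeE /= edge_sym; apply: univ.
split=> [a b|z [a [b /and3P[]]]].
  have conn_v (c : L) : connect (@edge L) c v'.
    by have [->|/to_v/connect1] := eqVneq c v'.
  apply: connect_trans (conn_v a) _; rewrite (sym_connect_sym (@edge_sym L)).
  exact: conn_v.
rewrite !inE => a_z b_z; apply/negP; rewrite negbK.
have [z_v|z_v] := eqVneq z v'; last first.
  have conn_v (c : L) : c != z -> connect (edge_avoiding [set z]) c v'.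
    move=> c_z; have [->|/to_v cv] := eqVneq c v'; first exact: connect0.
    by apply/connect1/and3P; split; rewrite ?inE ?[v' == z]eq_sym.
  apply: connect_trans (conn_v a a_z) _.
  by rewrite (sym_connect_sym (@edge_avoiding_sym L _)) conn_v.
have in_C (c : L) : c != z -> val c \in C.
  by have := valP c; rewrite z_v -val_eqE /= in_setU1 => /orP[->|].
have : connect (edge_avoiding [set v]) (val a) (val b).
  have := in_C b b_z; have := in_C a a_z; rewrite !inE.
  rewrite (sym_connect_sym (@edge_avoiding_sym G _)); exact: connect_trans.
(* The path in [G - v] never leaves [C], so it lifts step by step to [L] without [v']. *)
case/connectP=> p; elim: p a a_z => [|c p IHp] a a_z /=.
  by move=> _ /val_inj ->; apply: connect0.
case/andP=> ac p_path last_p.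
have Cc : c \in C.
  have := in_C a a_z; rewrite !inE => xa; apply: connect_trans xa _.
  exact: connect1.
have Lc : c \in v |: C by rewrite in_setU1 Cc orbT.
have c_z : (Sub c Lc : L) != z.
  by rewrite z_v -val_eqE /=; apply: component_avoiding_neq x_v Cc.
apply: connect_trans (IHp (Sub c Lc) c_z p_path last_p).
by apply/connect1/and3P; split; rewrite ?inE // edgeE; case/and3P: ac.
Qed.

(** A block stays connected without [v], hence lies in the cone over one component of [G - v]. The
    cone is nonseparable and induced, so maximality gives equality of both vertices and edges. *)
Lemma block_cone (G : sgraph) (v : G) (K : subgraph G) : universal_vertex v ->
  block K -> forall x, x \in sub_vertices K -> x != v ->
  sub_vertices K = v |: component_avoiding v x /\
  {in sub_vertices K &, sub_edge K =2 @edge G}.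
Proof.
move=> univ [[connK cutK] maxK] x Kx x_v.
set C := component_avoiding v x.
have sub_KL : sub_vertices K \subset v |: C.
  apply/subsetP => y Ky; rewrite in_setU1; case: eqVneq => //= y_v.
  pose x' : K := Sub x Kx; pose y' : K := Sub y Ky; rewrite inE.
  rewrite -[x]/(val x') -[y]/(val y').
  (* If [v] is in [K], it is not a cut vertex of [K]; if not, paths in [K] avoid [v] anyway. *)
  have [Kv|nKv] := boolP (v \in sub_vertices K).
    pose v' : K := Sub v Kv.
    apply: (connect_homo (e := edge_avoiding [set v'])).
      move=> a b /and3P[]; rewrite /edge_avoiding /= !inE -!val_eqE => -> -> /=.
      by case/sub_edgeP.
    apply/negPn/negP => nconn; apply: (cutK v'); exists x', y'.
    by rewrite /separator !inE -!val_eqE /= x_v y_v.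
  apply: (connect_homo (e := @edge K)); last exact: connK.
  move=> a b /sub_edgeP[Ka Kb ab]; rewrite /edge_avoiding /= !inE ab andbT.
  by rewrite (contraNneq _ nKv) ?(contraNneq _ nKv) // => <-.
have [|sub_LK edge_LK] := maxK _ (cone_nonseparable univ x_v).
  split=> // a b ab; have [Ka Kb eab] := sub_edgeP ab.
  by rewrite /= !(subsetP sub_KL).
split; first by apply/eqP; rewrite eqEsubset sub_KL.
move=> a b Ka Kb; apply/idP/idP => [/sub_edgeP[]//|ab]; apply: edge_LK.
by rewrite /= !(subsetP sub_KL).
Qed.

Lemma universal_relaxed_blocks (R : rcfType) (G : sgraph) (v : G) (K : subgraph G) :
  diam G = 2%N -> lambda2 R G < - (1 / 2) -> universal_vertex v -> block K ->
  [\/ complete K, isomorphic K full_house | isomorphic K diamond].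
Proof.
move=> diamG lam univ blockK.
(* A block without a vertex other than [v] has at most one vertex and is complete. *)
have [/exists_inP[x0 Kx0 x0_v]|] :=
    boolP [exists x in sub_vertices K, x != v]; last first.
  rewrite negb_exists_in => /forall_inP Kv; constructor 1 => x y.
  have /negPn/eqP xv := Kv _ (valP x); have /negPn/eqP yv := Kv _ (valP y).
  by rewrite -val_eqE xv yv eqxx.
have [Kvert Kedge] := block_cone univ blockK Kx0 x0_v.
pose C := component_avoiding v x0.
have C_v x : x \in C -> x != v by apply: component_avoiding_neq.
have vC x : x \in C -> v -- x by move/C_v/univ.
have [w Cw Cwx] : exists2 w, w \in C & {in C, forall x, x != w -> w -- x}.
  have [|a|a b c d ab bc cd a_c b_d|w x0w h] :=
      P4_C4_free_dominating x0 (e := edge_avoiding [set v]).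
  - exact: edge_avoiding_sym.
  - by rewrite /edge_avoiding /= edge_irrefl !andbF.
  - move: ab bc cd => /and3P[av bv ab] /and3P[_ cv bc] /and3P[_ dv cd].
    rewrite /edge_avoiding /= av bv cv dv /=.
    exact: (no_P4_C4 diamG lam ab bc cd).
  - exists w; rewrite ?inE // => x; rewrite inE => /h h' /h'.
    by case/and3P.
have [cliqueC|x y CE wx wy x_y nxy|x z y CE wx wz wy xz x_y z_y nxy nzy] :=
    neighborhood_componentP diamG lam vC Cw Cwx.
- constructor 1 => -[x Kx] [y Ky]; rewrite -val_eqE /edge /= Kedge //.
  move: Kx Ky; rewrite Kvert !in_setU1.
  have [->|_] := eqVneq x v; first by move=> _ _; rewrite eq_sym; apply: univ.
  have [->|_] := eqVneq y v; first by move=> _ _; rewrite edge_sym; apply: univ.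
  exact: cliqueC.
- constructor 3.
  have [vw vx vy] : [/\ v -- w, v -- x & v -- y].
    by split; apply: vC; rewrite CE !inE eqxx ?orbT.
  have Ks : sub_vertices K =i [tuple v; w; x; y].
    by move=> u; rewrite Kvert in_setU1 CE !inE.
  apply: (isomorphic_enum _ _ (s := [tuple v; w; x; y])) => //.
    by rewrite /= !inE !negb_or; graph_rewrite.
  move=> i j; rewrite Kedge ?Ks ?mem_tnth // !(tnth_nth v).
  case: i j => [[|[|[|[|?]]]] ?] [[|[|[|[|?]]]] ?] //=; rewrite ?edge_irrefl;
    by graph_rewrite.
constructor 2.
have [vw vx vy vz] : [/\ v -- w, v -- x, v -- y & v -- z].
  by split; apply: vC; rewrite CE !inE eqxx ?orbT.
have Ks : sub_vertices K =i [tuple v; w; x; z; y].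
  by move=> u; rewrite Kvert in_setU1 CE !inE.
apply: (isomorphic_enum _ _ (s := [tuple v; w; x; z; y])) => //.
  by rewrite /= !inE !negb_or; graph_rewrite.
move=> i j; rewrite Kedge ?Ks ?mem_tnth // !(tnth_nth v).
case: i j => [[|[|[|[|[|?]]]]] ?] [[|[|[|[|[|?]]]]] ?] //=; rewrite ?edge_irrefl;
  by graph_rewrite.
Qed.

Unset Implicit Arguments.

Theorem theorem2 (R : rcfType) (G : sgraph)
  (connG : connected G) (diamG : diam G = 2%N)
  (mvsG : exists2 S : {set G}, minimal_vertex_separator S & #|S| = 2%N)
  (lambda2G : lambda2 R G < - (1 / 2)) :
  exists2 H : sgraph, relaxed_block_star H &
    exists2 A : {set H}, connected (induced A) & isomorphic G (induced A).
Proof.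
have [S [x0 _] _] := mvsG.
(* As [G] is connected, a vertex dominating the component of [x0] is universal. *)
have [v univ] : exists v : G, universal_vertex v.
  have [|||v _ h] := P4_C4_free_dominating x0 (e := @edge G).
  - exact: edge_sym.
  - exact: edge_irrefl.
  - move=> a b c d; exact: (no_P4_C4 diamG lambda2G).
  - by exists v => y; apply: h; apply: connG.
exists G.
  split=> //; first by exists v.
  by move=> K; apply: universal_relaxed_blocks diamG lambda2G univ.
(* [G] and [induced [set: G]] have different vertex types, so the identity becomes the injection [f]
   into the subtype. *)
pose f (x : G) : induced [set: G] := Sub x (in_setT x).
have fE x y : (f x -- f y) = (x -- y) by rewrite {1}/edge /= !in_setT.
have valK : cancel val f by move=> x; apply: val_inj.
exists setT; last by exists f => //; exists val.
move=> x y; rewrite -(valK x) -(valK y).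
by apply: (connect_homo _ (connG (val x) (val y))) => a b; rewrite fE.
Qed.
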